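(* Let $r\ge4$. If $p=p(n)\le n^{-2/(r+2)}$, then with high probability as $n\to\infty$, \[T_r(n,p) \le \exp\bigg(\frac{O\big(n^{4-r}(\log n)^2\big)}{p^{\binom{r}{2}-2}}\bigg).\]
   Context: $G(n,p)$ is the Erdős–Rényi random graph on $n$ vertices with edge probability $p$. $T_r(n,p)$ is the number of orientations of $G(n,p)$ in which every copy of $K_r$ is transitively oriented. The $O(\cdot)$ hides a constant depending only on $r$. *)

(* Defs.v *)
From mathcomp Require Import all_boot all_order all_algebra.
From mathcomp Require Import all_classical all_reals all_analysis.

Set Implicit Arguments.
Unset Strict Implicit.
Unset Printing Implicit Defensive.

Import Order.TTheory GRing.Theory Num.Theory.
Import numFieldNormedType.Exports.

(* A simple graph on V is represented by its edge set, a subset of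
   [all_edges V]; a digraph is represented by its set of arcs. *)
Section Orientations.
Variable V : finType.
Implicit Types (E : {set {set V}}) (D : {set V * V}) (S : {set V}).

Definition all_edges : {set {set V}} := [set e : {set V} | #|e| == 2].

Definition is_clique E S : bool :=
  [forall x in S, forall y in S, (x != y) ==> ([set x; y]%SET \in E)].

Definition is_orientation E D : bool :=
  [forall x, forall y, ((x, y) \in D) ==> ([set x; y]%SET \in E)] &&
  [forall x, forall y,
     ([set x; y]%SET \in E) ==> (((x, y) \in D) (+) ((y, x) \in D))].

Definition transitive_on D S : bool :=
  [forall x in S, forall y in S, forall z in S,
     ((x, y) \in D) ==> ((y, z) \in D) ==> ((x, z) \in D)].

Definition num_orientations (r : nat) E : nat :=
  #|[set D : {set V * V} | is_orientation E D &&
      [forall S : {set V},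
         (#|S| == r) && is_clique E S ==> transitive_on D S]]|.

End Orientations.

Local Open Scope ring_scope.

(* The probability that G(n, p), on the vertex set 'I_n, satisfies A. *)
Definition gnp_prob (R : realType) (n : nat) (p : R)
    (A : {set {set 'I_n}} -> bool) : R :=
  \sum_(E in powerset (all_edges 'I_n) | A E)
    p ^+ #|E| * (1 - p) ^+ #|(all_edges 'I_n :\: E)%SET|.

(* Main.v *)
Require Import Defs.
From mathcomp Require Import all_boot all_order all_algebra.
From mathcomp Require Import all_classical all_reals all_analysis.
From mathcomp Require Import zify ring lra.
Import Order.TTheory GRing.Theory Num.Theory.
Import numFieldNormedType.Exports.
Set Implicit Arguments.
Unset Strict Implicit.
Unset Printing Implicit Defensive.
Local Open Scope ring_scope.

(* Write t = r - 3, m = 'C(r, 2) - 2, q = n^t p^m and L = ln n, so that the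
   bound in the exponent is of order n L^2 / q.

   Orient the graph vertex by vertex.  Once the arcs among the vertices before
   v are known, the set of out-neighbours of v among them is closed under the
   arcs a -> b for which v, a, b lie in a common K_r, hence it is determined by
   a minimal generating set, which contains no such arc.  If every set of 2s
   neighbours of v contains an edge ab such that v, a, b lie in a common K_r,
   the generating set has fewer than 2s elements, and the number of
   orientations is at most (n + 1)^(2sn).

   With s of order L / q this hypothesis holds with high probability when
   n p q is at least of order L^2: for fixed v and A, a Janson-type inequality
   bounds the failure probability by exp(-c s^2 q), which beats the union bound
   over A.  When n p q is smaller, n L^2 / q is at least of order n^2 p, and
   Markov's inequality applied to 2^|E| suffices. *)

(** * Random subsets *)

Section RandomSubset.
Import mathcomp.boot.fintype mathcomp.boot.finset.
Variables (R : realFieldType) (T : finType) (Om : {set T}) (p : R).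
Implicit Types (A B : pred {set T}) (E F : {set T}).

Definition subset_weight E : R := p ^+ #|E| * (1 - p) ^+ #|(Om :\: E)%SET|.
Definition Pr A : R := \sum_(E in powerset Om | A E) subset_weight E.

(** Expanding the product chooses x or y at each point of [Om]. With x = p and y = 1 - p this gives
    total mass 1; with x = 2p it gives the expectation of 2^|E|. *)
Lemma sum_powerset_exp (x y : R) :
  \sum_(E in powerset Om) x ^+ #|E| * y ^+ #|(Om :\: E)%SET| = (x + y) ^+ #|Om|.
Proof.
rewrite -prodr_const.
(* Points outside [Om] get the summands 0 and 1, so only subsets of [Om] survive in the
   expansion. *)
have -> : \prod_(i in Om) (x + y) =
    \prod_i ((if i \in Om then x else 0) + (if i \in Om then y else 1)).
  rewrite big_mkcond /=; apply: eq_bigr => i _.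
  by case: ifP => // _; rewrite add0r.
rewrite bigA_distr /= [RHS](bigID (fun E => E \in powerset Om)) /=.
rewrite [X in _ = _ + X]big1 ?addr0; last first.
  move=> E /=; rewrite powersetE => /subsetPn[e eE eO].
  by apply/eqP/prodf_eq0; exists e => //; rewrite eE (negbTE eO).
apply: eq_big => [E|E]; rewrite ?andbT //= powersetE => EO; apply/esym.
rewrite (bigID (mem E)) /=; congr (_ * _).
  rewrite -prodr_const; apply: eq_bigr => i iE.
  by rewrite iE (subsetP EO).
rewrite -prodr_const big_mkcond /= [RHS]big_mkcond /=; apply: eq_bigr => i _.
by rewrite !inE; case: (i \in E) => //=; case: (i \in Om).
Qed.

Lemma PrT : Pr xpredT = 1.
Proof.
rewrite /Pr (eq_bigl (fun E => E \in powerset Om)); last by move=> E; rewrite andbT.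
by rewrite sum_powerset_exp addrC subrK expr1n.
Qed.

Lemma PrC A B : Pr A = Pr (predI A B) + Pr (predI A (predC B)).
Proof.
rewrite /Pr (bigID B) /=; congr (_ + _); apply: eq_bigl => E /=;
  by rewrite -andbA.
Qed.

Lemma eq_Pr A B : (forall E, E \subset Om -> A E = B E) -> Pr A = Pr B.
Proof.
move=> AB; apply: eq_bigl => E; rewrite powersetE.
by case: (boolP (E \subset Om)) => //= /AB.
Qed.

(** On the right E and E :\ e are paired; their weights are in proportion p to 1 - p, so p times
    their sum is the weight of E. *)
Lemma Pr_cylinder1 (e : T) A : e \in Om ->
  Pr (fun E => (e \in E) && A E) = p * Pr (fun E => A (e |: E)%SET).
Proof.
move=> eO; rewrite /Pr mulr_sumr [RHS](bigID (fun E : {set T} => e \in E)) /=.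
rewrite [X in _ = _ + X](reindex_onto (fun E => (E :\ e)%SET) (fun E => (e |: E)%SET)) /=; last first.
  by move=> E /andP[_ eE]; rewrite setU1K.
rewrite [X in _ = _ + X](eq_bigl (fun E => (E \in powerset Om) && ((e \in E) && A E))); last first.
  move=> E; rewrite !powersetE !inE eqxx andbT /=.
  case: (boolP (e \in E)) => eE /=; last first.
    rewrite andbF; apply/negbTE; apply: contra eE => /andP[_ /eqP <-].
    by rewrite !inE eqxx.
  rewrite setD1K // eqxx andbT; congr (_ && _).
  by rewrite -{2}(setD1K eE) subUset finset.sub1set eO.
rewrite [X in _ = X + _](eq_bigl (fun E => (E \in powerset Om) && ((e \in E) && A E))); last first.
  move=> E; rewrite -andbA; case: (boolP (e \in E)) => eE; last by rewrite !andbF.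
  by rewrite andbT /= (setUidPr _) // finset.sub1set.
rewrite -big_split /=; apply: eq_bigr => E /and3P[]; rewrite powersetE => EO eE _.
rewrite /subset_weight.
have -> : #|E| = #|(E :\ e)%SET|.+1 by rewrite (cardsD1 e E) eE.
have -> : #|(Om :\: (E :\ e))%SET| = #|(Om :\: E)%SET|.+1.
  rewrite setDDr (cardsD1 e) !inE eqxx eO orbT /= add1n; congr _.+1.
  apply: eq_card => x; rewrite !inE; case: (eqVneq x e) => [->|] /=.
    by rewrite eE.
  by rewrite andbF orbF.
rewrite !exprS; ring.
Qed.

Lemma Pr_cylinder F A : F \subset Om ->
  Pr (fun E => (F \subset E) && A E) = p ^+ #|F| * Pr (fun E => A (F :|: E)%SET).
Proof.
elim: {F}#|F| {-2}F (erefl #|F|) A => [|n IHn] F cF A FO.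
  have /eqP -> : F == set0 by rewrite -cards_eq0 cF.
  rewrite cards0 expr0 mul1r; apply: eq_Pr => E _.
  by rewrite finset.sub0set set0U.
have /card_gt0P[e eF] : (0 < #|F|)%N by rewrite cF.
have cF' : #|(F :\ e)%SET| = n by apply/eqP; rewrite -eqSS -cF (cardsD1 e F) eF.
have FO' : (F :\ e)%SET \subset Om by apply: subset_trans FO; exact: subD1set.
transitivity (Pr (fun E => (e \in E) && ((F :\ e)%SET \subset E) && A E)).
  apply: eq_Pr => E _; rewrite -{1}(setD1K eF) subUset finset.sub1set.
  by [].
rewrite (eq_Pr (B := fun E => (e \in E) && (((F :\ e)%SET \subset E) && A E))); last first.
  by move=> E _; rewrite andbA.
rewrite Pr_cylinder1 ?(subsetP FO) //.
rewrite (eq_Pr (B := fun E => ((F :\ e)%SET \subset E) && A (e |: E)%SET)); last first.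
  move=> E _; congr (_ && _); rewrite subDset.
  by rewrite setUA setUid -subDset.
rewrite IHn // mulrA cF' -exprS cF; congr (_ * _).
apply: eq_Pr => E _; by rewrite setUA setD1K.
Qed.

Hypotheses (p0 : 0 <= p) (p1 : p <= 1).

Lemma subset_weight_ge0 E : 0 <= subset_weight E.
Proof. by rewrite mulr_ge0 ?exprn_ge0 // subr_ge0. Qed.

Lemma le_Pr A B : (forall E, E \subset Om -> A E -> B E) -> Pr A <= Pr B.
Proof.
move=> AB; rewrite /Pr [X in X <= _]big_mkcondr [X in _ <= X]big_mkcondr /=.
apply: ler_sum => E; rewrite powersetE => /AB.
by case: (A E) => [-> //|_]; case: ifP => // _; exact: subset_weight_ge0.
Qed.

Lemma Pr_ge0 A : 0 <= Pr A.
Proof. by apply: sumr_ge0 => E _; exact: subset_weight_ge0. Qed.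

Lemma Pr_le1 A : Pr A <= 1.
Proof. by rewrite -PrT; exact: le_Pr. Qed.

Lemma Pr_predC A : Pr A = 1 - Pr (predC A).
Proof.
rewrite -PrT (PrC xpredT A) (eq_Pr (A := predI xpredT A) (B := A)) //.
by rewrite (eq_Pr (A := predI xpredT (predC A)) (B := predC A)) // addrK.
Qed.

Lemma Pr_union (I : Type) (s : seq I) (P : pred I) A (B : I -> pred {set T}) :
  (forall E, E \subset Om -> A E -> has (fun i => P i && B i E) s) ->
  Pr A <= \sum_(i <- s | P i) Pr (B i).
Proof.
move=> AB; rewrite /Pr.
under [leRHS]eq_bigr do rewrite big_mkcondr.
rewrite exchange_big /= [leLHS]big_mkcondr /=.
apply: ler_sum => E; rewrite powersetE => EO.
have h0 s' : 0 <= \sum_(i <- s' | P i) (if B i E then subset_weight E else 0).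
  by apply: sumr_ge0 => i _; case: ifP => // _; exact: subset_weight_ge0.
case: ifP => // /(AB _ EO).
elim: s {AB} => //= i s IH /orP[/andP[Pi Bi]|/IH le_s].
  by rewrite big_cons Pi Bi lerDl.
rewrite big_cons; case: ifP => // _; apply: (le_trans le_s).
by rewrite lerDr; case: ifP => // _; exact: subset_weight_ge0.
Qed.

Lemma Pr_markov (f : {set T} -> R) (c : R) : 0 < c ->
  (forall E, 0 <= f E) ->
  Pr (fun E => c < f E) <= (\sum_(E in powerset Om) subset_weight E * f E) / c.
Proof.
move=> c0 f0; rewrite ler_pdivlMr // /Pr mulr_suml big_mkcondr /=.
apply: ler_sum => E _; case: ifP => [cf|_].
  by rewrite ler_wpM2l ?subset_weight_ge0 // ltW.
by rewrite mulr_ge0 ?subset_weight_ge0.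
Qed.

Definition avoids (I : Type) (F : I -> {set T}) (s : seq I) : pred {set T} :=
  fun E => all (fun x => ~~ (F x \subset E)) s.

(* A local form of Janson's inequality.  Conditioning on F x \subset E
   amounts to replacing E by F x :|: E, so that no correlation inequality
   is needed: avoids is decreasing in E. *)
Lemma janson (I : eqType) (F : I -> {set T}) (s : seq I) :
  uniq s -> (forall x, x \in s -> F x \subset Om) ->
  (forall x, x \in s ->
     \sum_(y <- s | (y != x) && ~~ [disjoint F y & F x])
        p ^+ #|(F y :\: F x)%SET| <= 2^-1) ->
  Pr (avoids F s) <= \prod_(x <- s) (1 - p ^+ #|F x| / 2).
Proof.
elim: s => [|x s IH] /=; first by move=> _ _ _; rewrite big_nil Pr_le1.
case/andP=> xs us FO dep.
have FxO : F x \subset Om by apply: FO; rewrite inE eqxx.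
have FsO y : y \in s -> F y \subset Om by move=> ys; apply: FO; rewrite inE ys orbT.
have pF z : 0 <= p ^+ #|F z| <= 1 by rewrite exprn_ge0 //= exprn_ile1.
have {}IH : Pr (avoids F s) <= \prod_(x <- s) (1 - p ^+ #|F x| / 2).
  apply: IH => // y ys; apply: le_trans (dep y _); last by rewrite inE ys orbT.
  rewrite big_cons; case: ifP => // _; by rewrite lerDr exprn_ge0.
rewrite big_cons.
apply: (@le_trans _ _ ((1 - p ^+ #|F x| / 2) * Pr (avoids F s))); last first.
  apply: ler_wpM2l => //; have := pF x; lra.
have -> : Pr (avoids F (x :: s)) =
    Pr (avoids F s) - p ^+ #|F x| * Pr (fun E => avoids F s (F x :|: E)%SET).
  rewrite -Pr_cylinder // [in RHS](PrC (avoids F s) (fun E => F x \subset E)).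
  rewrite (eq_Pr (A := predI _ _) (B := fun E => (F x \subset E) && avoids F s E)); last first.
    by move=> E _ /=; rewrite andbC.
  rewrite addrAC subrr add0r; apply: eq_Pr => E _ /=; by rewrite andbC.
(* It is enough that adding [F x] to E at most halves the probability of avoidance. *)
suff : Pr (avoids F s) / 2 <= Pr (fun E => avoids F s (F x :|: E)%SET).
  move=> h; have := ler_wpM2l (proj1 (andP (pF x))) h; lra.
pose indep := [seq y <- s | [disjoint F y & F x]].
pose dpd y := ~~ [disjoint F y & F x].
have indep_le : Pr (avoids F s) <= Pr (avoids F indep).
  apply: le_Pr => E _ /allP av; apply/allP => y; rewrite mem_filter => /andP[_].
  exact: av.
(* If E avoids the sets disjoint from [F x] while [F x :|: E] fails to avoid s, the failure comes
   from a dependent y with [F y :\: F x] contained in E. *)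
have cover : Pr (avoids F indep) <=
    Pr (fun E => avoids F s (F x :|: E)%SET) +
    \sum_(y <- s | dpd y) Pr (fun E => ((F y :\: F x)%SET \subset E) && avoids F indep E).
  rewrite (PrC (avoids F indep) (fun E => avoids F s (F x :|: E)%SET)) lerD //.
    by apply: le_Pr => E _ /= /andP[].
  apply: Pr_union => E _ /= /andP[avi /allPn[y ys]]; rewrite negbK => FyE.
  apply/hasP; exists y => //; rewrite subDset FyE avi andbT andbT.
  apply/negP => dis; have /allP/(_ y) := avi; rewrite mem_filter dis ys => /(_ isT).
  move/negP; apply; apply/subsetP => e ey.
  have := subsetP FyE _ ey; rewrite inE => /orP[ex|//].
  by have := disjointFr dis ey; rewrite ex.
(* Avoidance is decreasing, so adding [F y :\: F x] can only lower its probability. *)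
have dep_le y : y \in s ->
    Pr (fun E => ((F y :\: F x)%SET \subset E) && avoids F indep E) <=
    p ^+ #|(F y :\: F x)%SET| * Pr (avoids F indep).
  move=> ys; rewrite Pr_cylinder; last first.
    by apply: subset_trans (FsO _ ys); exact: subsetDl.
  rewrite ler_wpM2l ?exprn_ge0 //; apply: le_Pr => E _ /allP av.
  apply/allP => z /av; apply: contra => /subset_trans; apply; exact: subsetUr.
have sum_le : \sum_(y <- s | dpd y) Pr (fun E => ((F y :\: F x)%SET \subset E) && avoids F indep E)
   <= 2^-1 * Pr (avoids F indep).
  apply: (@le_trans _ _ (\sum_(y <- s | dpd y) p ^+ #|(F y :\: F x)%SET| * Pr (avoids F indep))).
    rewrite big_seq_cond [leRHS]big_seq_cond; apply: ler_sum => y /andP[ys _].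
    exact: dep_le.
  rewrite -mulr_suml ler_wpM2r ?Pr_ge0 //.
  have := dep x; rewrite inE eqxx => /(_ isT); apply: le_trans.
  rewrite big_cons eqxx /= big_seq_cond [leRHS]big_seq_cond le_eqVlt; apply/orP; left.
  apply/eqP; apply: eq_bigl => y; case: (boolP (y \in s)) => //= ys.
  by rewrite (_ : y != x) //; apply: contraNneq xs => <-.
have := Pr_ge0 (avoids F s); lra.
Qed.

End RandomSubset.

(** * Encoding of orientations *)

Section CountingOrientations.
Import mathcomp.boot.fintype mathcomp.boot.finset.
Local Open Scope nat_scope.

Lemma exists_subset_card (T : finType) (A : {set T}) (k : nat) :
  k <= #|A| -> exists2 B : {set T}, B \subset A & #|B| = k.
Proof.
move=> kA; exists [set x in take k (enum A)].
  by apply/subsetP => x; rewrite inE => /mem_take; rewrite mem_enum.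
rewrite cardsE; move/card_uniqP: (take_uniq k (enum_uniq (mem A))) => ->.
by rewrite size_takel // -cardE.
Qed.

Lemma card_small_sets (T : finType) (k : nat) :
  #|[set A : {set T} | #|A| <= k]| <= #|T|.+1 ^ k.
Proof.
pose f (g : {ffun 'I_k -> option T}) : {set T} :=
  [set x | [exists i, g i == Some x]].
have -> : #|T|.+1 ^ k = #|{ffun 'I_k -> option T}|.
  by rewrite card_ffun card_option card_ord.
apply: leq_trans (leq_imset_card f _); apply: subset_leq_card.
apply/subsetP => A; rewrite inE => Ak.
apply/imsetP; exists [ffun i : 'I_k => onth (enum A) i] => //.
apply/setP => x; rewrite inE; apply/idP/existsP => [xA|[i]].
  have xs : index x (enum A) < size (enum A) by rewrite index_mem mem_enum.
  have ik : index x (enum A) < k by rewrite (leq_trans xs) // -cardE.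
  exists (Ordinal ik); rewrite ffunE /= onthE (nth_map x) //.
  by rewrite nth_index ?mem_enum.
rewrite ffunE onthE; have [si|is_] := leqP (size (enum A)) i.
  by rewrite nth_default ?size_map.
by rewrite (nth_map x) // => /eqP[<-]; rewrite -mem_enum mem_nth.
Qed.

Variable n r : nat.
Implicit Types (E : {set {set 'I_n}}) (D : {set 'I_n * 'I_n}) (v : 'I_n).

Definition good_orientation E D : bool :=
  is_orientation E D &&
  [forall S : {set 'I_n}, (#|S| == r) && is_clique E S ==> transitive_on D S].

Definition clique_through E v a b : bool :=
  [exists S : {set 'I_n},
     [&& #|S| == r, is_clique E S, v \in S, a \in S & b \in S]].

(** Along such an arc, v -> a forces v -> b by transitivity on the common K_r. Both ends precede v,
    so only arcs known before v is treated are consulted. *)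
Definition earlier_arc E D v : rel 'I_n :=
  fun a b => [&& (a, b) \in D, a < v, b < v & clique_through E v a b].

Definition earlier_out D v : {set 'I_n} := [set u : 'I_n | (u < v) && ((v, u) \in D)].

Definition reach E D v (I : {set 'I_n}) : {set 'I_n} :=
  [set b | [exists a in I, connect (earlier_arc E D v) a b]].

(** For a good orientation the seed [earlier_out D v] of the minimum is itself admissible, by
    [reach_earlier_out]. *)
Definition code E D : {ffun 'I_n -> {set 'I_n}} :=
  [ffun v => [arg min_(I < earlier_out D v | reach E D v I == earlier_out D v) #|I|]].

Lemma good_orientation_arc E D x y : good_orientation E D ->
  ((x, y) \in D) = ([set x; y] \in E) && ((y, x) \notin D).
Proof.
case/andP=> /andP[/'forall_forallP/(_ x y)/implyP sub /'forall_forallP/(_ x y)/implyP ex] _.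
apply/idP/andP => [xy|[xyE /negbTE yx]].
  by have xyE := sub xy; split => //; have := ex xyE; rewrite xy => /=.
by have := ex xyE; rewrite yx addbF.
Qed.

Lemma good_orientation_trans E D v a b : good_orientation E D ->
  clique_through E v a b -> (v, a) \in D -> (a, b) \in D -> (v, b) \in D.
Proof.
case/andP=> _ /forallP good /existsP[S /and5P[cS clS vS aS bS]] va ab.
have := good S; rewrite cS clS /= => /forallP/(_ v); rewrite vS /=.
move=> /forallP/(_ a); rewrite aS /= => /forallP/(_ b); rewrite bS /=.
by rewrite va ab.
Qed.

Lemma reach_sub E D v (I : {set 'I_n}) : I \subset reach E D v I.
Proof. by apply/subsetP => a aI; rewrite inE; apply/existsP; exists a; rewrite aI connect0. Qed.

Lemma reach_earlier_out E D v : good_orientation E D ->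
  reach E D v (earlier_out D v) = earlier_out D v.
Proof.
move=> good; apply/eqP; rewrite eqEsubset reach_sub andbT.
apply/subsetP => b; rewrite inE => /existsP[a /andP[aO /connectP[s sP ->]]].
elim: s a aO sP => //= c s IH a aO /andP[/and4P[ac _ cv cl] sP].
apply: IH => //; move: aO; rewrite !inE cv => /andP[_ va] /=.
exact: good_orientation_trans cl va ac.
Qed.

Lemma reach_code E D v : good_orientation E D ->
  reach E D v (code E D v) = earlier_out D v.
Proof.
move=> good; rewrite ffunE; case: arg_minnP => [|I /eqP //].
by rewrite reach_earlier_out.
Qed.

(* If b were the end of an arc from a, then I :\ b would be a smaller
   generating set. *)
Lemma code_independent E D v a b : good_orientation E D ->
  a \in code E D v -> b \in code E D v -> a != b -> ~~ earlier_arc E D v a b.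
Proof.
move=> good; rewrite ffunE; case: arg_minnP => [|I /eqP Igen Imin aI bI ab].
  by rewrite reach_earlier_out.
apply/negP => arc; have := Imin (I :\ b).
rewrite (cardsD1 b I) bI add1n ltnn => /(_ _)/notF; apply.
rewrite eqEsubset -Igen; apply/andP; split; apply/subsetP => x; rewrite !inE.
  case/existsP=> c /andP[/setD1P[_ cI] cx].
  by apply/existsP; exists c; rewrite cI.
case/existsP=> c /andP[cI cx]; apply/existsP.
have [cb|cb] := eqVneq c b; last by exists c; rewrite !inE cb cI.
exists a; rewrite !inE ab aI /=; apply: (connect_trans (connect1 arc)).
by rewrite -cb.
Qed.

(** The arcs among the first k vertices are recovered by induction on k: the code of vertex k and
    the earlier arcs give its earlier out-neighbours, and as each edge is oriented exactly one way
    this also fixes its earlier in-neighbours. *)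
Lemma code_inj E D D' : good_orientation E D -> good_orientation E D' ->
  code E D = code E D' -> D = D'.
Proof.
move=> good good' eqc.
suff agree k (x y : 'I_n) : x < k -> y < k -> ((x, y) \in D) = ((x, y) \in D').
  by apply/setP => -[x y]; apply: (agree n).
elim: k x y => // k IH.
have out_eq (v : 'I_n) : v = k :> nat -> earlier_out D v = earlier_out D' v.
  move=> vk; rewrite -(reach_code v good) -(reach_code v good') -eqc.
  apply/setP => b; rewrite !inE; apply: eq_existsb => a; congr (_ && _).
  apply: eq_connect => {}a {}b; rewrite /earlier_arc.
  case: (ltnP a v) => av; last by rewrite !andbF.
  case: (ltnP b v) => bv; last by rewrite !andbF.
  by rewrite IH // -vk.
have fwd (v u : 'I_n) : v = k :> nat -> u < k -> ((v, u) \in D) = ((v, u) \in D').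
  by move=> vk uk; have /setP/(_ u) := out_eq v vk; rewrite !inE vk uk.
move=> x y; rewrite !ltnS.
case: (ltngtP x k) => // xk _; case: (ltngtP y k) => // yk _.
- exact: IH.
- by rewrite (good_orientation_arc _ _ good) (good_orientation_arc _ _ good') fwd.
- exact: fwd.
have -> : y = x by apply: val_inj; rewrite /= xk yk.
rewrite (good_orientation_arc _ _ good) (good_orientation_arc _ _ good').
have loop D0 : good_orientation E D0 -> (x, x) \in D0 = false.
  move=> g; apply/negP => xx; have := xx; rewrite (good_orientation_arc _ _ g) xx.
  by rewrite andbF.
by rewrite !loop.
Qed.

(** A code of at least s vertices would contain s neighbours of v, among them a and b joined by an
    edge in a common K_r with v. Either direction of ab would be an earlier arc, against
    [code_independent]. So each of the n codes has fewer than s elements. *)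
Lemma num_orientations_le_exp E (s : nat) :
  (forall v (A : {set 'I_n}), #|A| = s -> (forall a, a \in A -> [set v; a] \in E) ->
     exists a b, [/\ a \in A, b \in A, a != b & clique_through E v a b]) ->
  num_orientations r E <= (n.+1 ^ s) ^ n.
Proof.
move=> rich.
have code_lt D v : good_orientation E D -> #|code E D v| < s.
  move=> good; rewrite ltnNge; apply/negP => /exists_subset_card[A Asub cA].
  have vA a : a \in A -> (v, a) \in D.
    move=> /(subsetP Asub) aI; have : a \in reach E D v (code E D v).
      exact: (subsetP (reach_sub _ _ _ _)).
    by rewrite reach_code // inE => /andP[].
  have v_lt a : a \in A -> a < v.
    move=> /(subsetP Asub) aI; have : a \in reach E D v (code E D v).
      exact: (subsetP (reach_sub _ _ _ _)).
    by rewrite reach_code // inE => /andP[].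
  case: (rich v A cA) => [a /vA|a [b [aA bA ab cl]]].
    by rewrite (good_orientation_arc _ _ good) => /andP[].
  have abE : [set a; b] \in E.
    case/existsP: cl => S /and5P[_ /forall_inP/(_ a) cS _ aS bS].
    by have /forall_inP/(_ b bS) := cS aS; rewrite ab.
  have cl' : clique_through E v b a.
    by case/existsP: cl => S /and5P[? ? ? ? ?]; apply/existsP; exists S; apply/and5P.
  have := code_independent good (subsetP Asub _ aA) (subsetP Asub _ bA) ab.
  have := code_independent good (subsetP Asub _ bA) (subsetP Asub _ aA).
  rewrite eq_sym => /(_ ab); rewrite /earlier_arc !v_lt // cl cl' !andbT.
  rewrite (good_orientation_arc a b good) abE => /negbTE ->.
  by [].
rewrite /num_orientations -/(good_orientation E _).
rewrite -(card_in_imset (f := code E)); last first.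
  by move=> D D'; rewrite !inE; exact: code_inj.
apply: (@leq_trans #|ffun_on (mem [set I : {set 'I_n} | #|I| <= s])|).
  apply: subset_leq_card; apply/subsetP => _ /imsetP[D good ->].
  apply/ffun_onP => v; rewrite !inE ltnW // code_lt //.
  by rewrite inE in good.
rewrite card_ffun_on card_ord.
have mono e a b : a <= b -> a ^ e <= b ^ e by case: e => // e; rewrite leq_exp2r.
by apply: mono; have := card_small_sets 'I_n s; rewrite card_ord.
Qed.

(** An orientation is determined by the set [f D] of edges directed from the smaller to the larger
    endpoint. *)
Lemma num_orientations_le_edges E : num_orientations r E <= 2 ^ #|E|.
Proof.
rewrite -card_powerset /num_orientations -/(good_orientation E _).
pose f D : {set {set 'I_n}} :=
  [set e in E | [exists x : 'I_n, exists y : 'I_n, [&& x < y, e == [set x; y] & (x, y) \in D]]].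
rewrite -(card_in_imset (f := f)).
  apply: subset_leq_card; apply/subsetP => _ /imsetP[D _ ->]; rewrite powersetE.
  by apply/subsetP => e; rewrite inE => /andP[].
move=> D D'; rewrite !inE => good good' eqf.
have lt_eq (x y : 'I_n) : x < y -> ((x, y) \in D) = ((x, y) \in D').
  have fE D0 : x < y -> good_orientation E D0 -> ((x, y) \in D0) = ([set x; y] \in f D0).
    move=> xy g; rewrite inE; apply/idP/andP => [xyD|[_ /existsP[x' /existsP[y' /and3P[xy' /eqP eqe]]]]].
      split; first by move: xyD; rewrite (good_orientation_arc _ _ g) => /andP[].
      by apply/existsP; exists x; apply/existsP; exists y; rewrite xy eqxx.
    have := set21 x y; have := set22 x y; rewrite eqe !inE.
    move=> /orP[]/eqP hy /orP[]/eqP hx; subst => //; try by rewrite ltnn in xy.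
    by rewrite ltnNge ltnW in xy.
  by move=> xy; rewrite !fE // eqf.
apply/setP => -[x y]; case: (ltngtP x y) => xy; first exact: lt_eq.
  by rewrite (good_orientation_arc _ _ good) (good_orientation_arc _ _ good') lt_eq.
have -> : y = x by apply: val_inj.
have loop D0 : good_orientation E D0 -> (x, x) \in D0 = false.
  move=> g; apply/negP => xx; have := xx; rewrite (good_orientation_arc _ _ g) xx.
  by rewrite andbF.
by rewrite !loop.
Qed.

End CountingOrientations.

(** * Partite copies of a graph in a random graph *)

Section PartiteCopies.
Import mathcomp.boot.fintype mathcomp.boot.finset.
Variables (T J : finType) (V : J -> {set T}) (Q : {set {set J}}).
Hypothesis disjV : forall i j u, u \in V i -> u \in V j -> i = j.
Implicit Types (x y : {ffun J -> T}) (I q : {set J}).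

Definition copy x : {set {set T}} := [set x @: (q : {set J}) | q in Q].
Definition agree x y : {set J} := [set i | x i == y i].
Definition partite : {pred {ffun J -> T}} := family (fun i => mem (V i)).

Lemma partiteP x : reflect (forall i, x i \in V i) (x \in partite).
Proof. exact: familyP. Qed.

(** The parts are disjoint, so a vertex in the image of a partite map reveals its index; equal
    images therefore come from equal index sets, on which the maps agree. *)
Lemma eq_imset_partite x y q q' : x \in partite -> y \in partite ->
  x @: q = y @: q' -> q = q' /\ q \subset agree x y.
Proof.
move=> /partiteP xV /partiteP yV eqi.
have sub (z w : {ffun J -> T}) (b c : {set J}) : (forall i, z i \in V i) ->
    (forall i, w i \in V i) -> z @: b = w @: c ->
    forall i, i \in b -> i \in c /\ z i = w i.
  move=> zV wV eqzw i ib; have : z i \in w @: c by rewrite -eqzw imset_f.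
  case/imsetP=> j jc zw; suff ij : i = j by subst j.
  by apply: (disjV (zV i)); rewrite zw.
split; last by apply/subsetP => i /(sub _ _ _ _ xV yV eqi)[_ xy]; rewrite inE xy.
apply/setP => i; apply/idP/idP => [/(sub _ _ _ _ xV yV eqi)[]|] //.
by move/(sub _ _ _ _ yV xV (esym eqi)) => [].
Qed.

Lemma imset_agree x y q : q \subset agree x y -> x @: q = y @: q.
Proof.
by move=> /subsetP qI; apply: eq_in_imset => i /qI; rewrite inE => /eqP.
Qed.

Lemma card_copy_partite x : x \in partite -> #|copy x| = #|Q|.
Proof.
move=> xV; rewrite card_in_imset // => q q' _ _ /(eq_imset_partite xV xV).
by case.
Qed.

Lemma card_copyD x y : x \in partite -> y \in partite ->
  #|copy y :\: copy x| = #|Q :\: powerset (agree x y)|.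
Proof.
move=> xV yV.
rewrite -(card_in_imset (f := fun q : {set J} => y @: q) (D := mem (Q :\: powerset (agree x y)))); last first.
  by move=> q q' _ _ /(eq_imset_partite yV yV)[].
apply: eq_card => e; apply/setDP/imsetP => [[/imsetP[q qQ ->] nx]|[q]].
  exists q => //; rewrite inE qQ andbT powersetE; apply: contra nx => qI.
  by rewrite -(imset_agree qI) imset_f.
rewrite inE powersetE => /andP[qI qQ] ->; split; first exact: imset_f.
apply: contra qI => /imsetP[q' _ eqi].
have [qq'] := eq_imset_partite yV xV eqi.
by move/subsetP => s; apply/subsetP => i /s; rewrite !inE eq_sym.
Qed.

Lemma agree_inhabited x y : x \in partite -> y \in partite ->
  ~~ [disjoint copy y & copy x] -> exists2 q, q \in Q & q \subset agree x y.
Proof.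
move=> xV yV /pred0Pn[e /andP[/imsetP[q qQ ->] /imsetP[q' q'Q eqi]]].
exists q => //; have [_ /subsetP s] := eq_imset_partite yV xV eqi.
by apply/subsetP => i /s; rewrite !inE eq_sym.
Qed.

Lemma card_partite : #|partite| = (\prod_i #|V i|)%N.
Proof. by rewrite card_family foldrE big_image. Qed.

(** Coordinates in I are dictated by x; the others are counted as free in their parts, ignoring that
    they must differ from x. *)
Lemma card_agree x I :
  (#|[set y | (y \in partite) && (agree x y == I)]| <= \prod_(i in ~: I) #|V i|)%N.
Proof.
pose F i : {set T} := if i \in I then [set x i] else V i.
apply: (@leq_trans #|family (fun i => mem (F i))|).
  apply: subset_leq_card; apply/subsetP => y; rewrite inE => /andP[/partiteP yV /eqP aI].
  apply/familyP => i; suff : y i \in F i by [].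
  rewrite /F; case: ifP => [|_]; last exact: yV.
  by rewrite -aI !inE eq_sym.
rewrite card_family foldrE big_image /= (bigID (mem I)) /=.
rewrite big1 ?mul1n => [|i iI]; last first.
  rewrite (_ : #|_| = #|F i|); last by apply: eq_card.
  by rewrite /F iI cards1.
rewrite leq_eqVlt; apply/orP; left; apply/eqP; apply: eq_big => i; rewrite ?inE //.
move=> iI; rewrite (_ : #|_| = #|F i|); last by apply: eq_card.
by rewrite /F (negbTE iI).
Qed.

Variables (R : realFieldType) (Om : {set {set T}}) (p : R).
Hypotheses (p0 : 0 <= p) (p1 : p <= 1).
Hypothesis copyO : forall x, x \in partite -> copy x \subset Om.

(** The inequality [janson] is applied to all partite maps. The y whose copy meets that of x are
    grouped by I = [agree x y]; each of the 2^|J| classes contributes at most 2^-(|J|+1), for a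
    total of at most 1/2. *)
Lemma Pr_no_partite_copy :
  (forall I, I != setT -> (exists2 q, q \in Q & q \subset I) ->
     (forall i, #|V i| = 1%N -> i \in I) ->
     (\prod_(i in ~: I) #|V i|)%:R * p ^+ #|Q :\: powerset I| <= (2 ^+ #|J|.+1)^-1) ->
  Pr Om p (fun E => [forall x in partite, ~~ (copy x \subset E)]) <=
  (1 - p ^+ #|Q| / 2) ^+ (\prod_i #|V i|)%N.
Proof.
move=> H.
rewrite (eq_Pr _ (B := avoids copy (enum partite))); last first.
  move=> E _; apply/forall_inP/allP => h x; first by rewrite mem_enum; exact: h.
  by move=> xV; apply: h; rewrite mem_enum.
rewrite -card_partite.
apply: le_trans (janson (Om := Om) p0 p1 _ _ _) _.
- exact: enum_uniq.
- by move=> x; rewrite mem_enum; exact: copyO.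
- move=> x; rewrite mem_enum => xV; rewrite big_enum_cond /=.
  rewrite (partition_big (agree x) xpredT) //=.
  apply: (@le_trans _ _ (\sum_(I : {set J}) (2 ^+ #|J|.+1)^-1)).
    apply: ler_sum => I _.
    (* An empty class contributes 0; otherwise a member y0 supplies the three conditions on I. *)
    have [y0 Py0|noP] := pickP (fun y => [&& y \in partite, y != x &
      ~~ [disjoint copy y & copy x]] && (agree x y == I)); last first.
      by rewrite big_pred0 // invr_ge0 exprn_ge0.
    have {}H : (\prod_(i in ~: I) #|V i|)%:R * p ^+ #|Q :\: powerset I| <= (2 ^+ #|J|.+1)^-1.
      case/andP: Py0 => /and3P[y0V y0x dis] /eqP aI; apply: H.
      - apply: contraNneq y0x => IT; apply/eqP/ffunP => i; apply/eqP.
        by have := in_setT i; rewrite -IT -aI inE eq_sym.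
      - by rewrite -aI; exact: agree_inhabited.
      move=> i /eqP/cards1P[u Vu]; rewrite -aI inE.
      move/partiteP/(_ i): xV; move/partiteP/(_ i): y0V.
      by rewrite Vu !inE => /eqP -> /eqP ->.
    apply: le_trans H.
    rewrite (eq_bigr (fun=> p ^+ #|Q :\: powerset I|)); last first.
      by move=> y /andP[/andP[yV _] /eqP aI]; rewrite card_copyD // aI.
    rewrite sumr_const -[X in X <= _]mulr_natl ler_wpM2r ?exprn_ge0 // ler_nat.
    apply: leq_trans (card_agree x I); apply: subset_leq_card.
    by apply/subsetP => y /andP[/andP[yV _] aI]; rewrite inE yV.
  rewrite sumr_const.
  have -> : #|{set J}| = (2 ^ #|J|)%N by have := card_powerset [set: J]; rewrite powersetT !cardsT.
  rewrite -[leLHS]mulr_natl natrX exprS invfM mulrCA divff ?mulr1 //.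
rewrite big_enum /= (eq_bigr (fun=> 1 - p ^+ #|Q| / 2)); last first.
  by move=> x xV; rewrite card_copy_partite.
by rewrite prodr_const.
Qed.

End PartiteCopies.

(** * The pattern: K_r without the edges from the root to the two hubs *)

Section Pattern.
Import mathcomp.boot.fintype mathcomp.boot.finset.
Local Open Scope nat_scope.
Variable t : nat.
Notation r := t.+3.

(* The indices 0, 1, 2 stand for v, a, b and the others for the remaining
   vertices of a K_r.  The edges va and vb are left out of the pattern because
   a and b are taken among the neighbours of v. *)
Definition hubs : {set 'I_r} := [set i : 'I_r | 0 < i < 3].
Definition pattern : {set {set 'I_r}} :=
  all_edges 'I_r :\: [set [set ord0; u] | u in hubs].
(* Number of pattern edges spanned by 0, a of the hubs and j other indices. *)
Definition shared (a j : nat) : nat := 'C((a + j).+1, 2) - a.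

Definition far : {set 'I_r} := [set i : 'I_r | 3 <= i].

Lemma card_hubs : #|hubs| = 2.
Proof.
have -> : hubs = [set @Ordinal r 1 isT; @Ordinal r 2 isT].
  by apply/setP => -[[|[|[|i]]] hi]; rewrite !inE.
by rewrite cards2.
Qed.

Lemma card_rooted (I : {set 'I_r}) :
  ord0 \in I -> #|I| = (#|I :&: hubs| + #|I :&: far|).+1.
Proof.
move=> I0; rewrite (cardsD1 ord0) I0 add1n; congr _.+1.
rewrite -cardsUI [X in _ = _ + X](_ : _ = 0) ?addn0.
  apply: eq_card => i; rewrite !inE -val_eqE /=.
  by case: (i \in I); rewrite ?andbF //=; case: (nat_of_ord i) => [|[|[|]]].
apply/eqP; rewrite cards_eq0; apply/eqP/setP => i; rewrite !inE.
by case: (nat_of_ord i) => [|[|[|k]]]; rewrite ?andbF.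
Qed.

Lemma card_far : #|far| = t.
Proof.
have := card_rooted (in_setT ord0); rewrite !setTI card_hubs cardsT card_ord.
by case.
Qed.

(** All pairs inside I count, except one pair for each hub of I, formed with the root. *)
Lemma card_pattern_powerset (I : {set 'I_r}) : ord0 \in I ->
  #|pattern :&: powerset I| = shared #|I :&: hubs| #|I :&: far|.
Proof.
move=> I0; rewrite /shared -card_rooted //.
have -> : pattern :&: powerset I =
    [set e : {set 'I_r} | (e \subset I) && (#|e| == 2)] :\: [set [set ord0; u] | u in I :&: hubs].
  apply/setP => e; rewrite !inE; apply/andP/and3P => [[/andP[nh c2] eI]|[nh eI c2]]; split=> //.
    by apply: contra nh => /imsetP[u]; rewrite inE => /andP[_ uh] ->; apply/imsetP; exists u.
  rewrite c2 andbT; apply: contra nh => /imsetP[u uh eqe]; apply/imsetP; exists u => //.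
  by rewrite inE uh andbT (subsetP eI) // eqe set22.
rewrite cardsDS; last first.
  apply/subsetP => e /imsetP[u]; rewrite inE => /andP[uI]; rewrite inE => u0 ->.
  rewrite inE subUset !sub1set I0 uI cards2 /= -val_eqE /=.
  by case: (nat_of_ord u) u0.
rewrite cards_draws card_in_imset // => u u'; rewrite !inE => /andP[_ /andP[u0 _]] _ eqe.
have := set22 ord0 u; rewrite eqe !inE => /orP[]/eqP // e0.
by rewrite e0 in u0.
Qed.

Lemma card_pattern : #|pattern| = shared 2 t.
Proof.
rewrite -[pattern]setIT -powersetT card_pattern_powerset ?inE //.
by rewrite !setTI card_hubs card_far.
Qed.

Lemma card_patternD (I : {set 'I_r}) : ord0 \in I ->
  #|pattern :\: powerset I| = shared 2 t - shared #|I :&: hubs| #|I :&: far|.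
Proof. by move=> I0; rewrite cardsD card_pattern card_pattern_powerset. Qed.

End Pattern.

(** * Large sets of neighbours of v contain an edge in a common K_r with v *)

Section RichNeighbourhoods.
Import mathcomp.boot.fintype mathcomp.boot.finset.
Variables t n s k : nat.
Notation r := t.+3.
Hypothesis room : (1 + s * 2 + t * k <= n)%N.
Implicit Types (E : {set {set 'I_n}}) (A : {set 'I_n}) (v : 'I_n).

Lemma exists_blocks v A : v \notin A -> #|A| = (s * 2)%N ->
  exists V : 'I_r -> {set 'I_n},
    [/\ forall i j u, u \in V i -> u \in V j -> i = j,
        V ord0 = [set v],
        forall i, i \in hubs t -> V i \subset A /\ #|V i| = s &
        forall i, i \in far t -> #|V i| = k].
Proof.
move=> vA cA.
(* The vertices are listed as v, then A, then the rest. The parts are consecutive intervals of this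
   list, the hubs receiving the two halves of A. *)
pose sq := v :: enum A ++ enum (~: (v |: A)).
have usq : uniq sq.
  rewrite /= mem_cat !mem_enum !inE eqxx /= orbF vA /= cat_uniq !enum_uniq andbT /=.
  apply/hasPn => u; rewrite mem_enum !inE negb_or => /andP[_ uA] /=.
  by rewrite mem_enum.
have ssq : size sq = n.
  rewrite /= size_cat -!cardE cardsCs setCK card_ord cardsU1 vA cA; lia.
pose off (i : nat) := match i with 0 => 0 | 1 => 1 | 2 => s.+1 | i.+3 => (s * 2 + i * k).+1 end%N.
pose len (i : nat) := match i with 0 => 1 | 1 => s | 2 => s | i.+3 => k end%N.
have off_n (i : 'I_r) : (off i + len i <= n)%N.
  case: i => -[|[|[|i]]] /= hi; try lia.
  have : (i.+1 * k <= t * k)%N by rewrite leq_mul2r -(leq_add2r 3) !addn3 hi orbT.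
  rewrite mulSn; move: room => h1 h2. lia.
have off_mono (i j : nat) : (i < j)%N -> (off i + len i <= off j)%N.
  case: i => [|[|[|i]]]; case: j => [|[|[|j]]] //; rewrite /off /len; try lia.
  move=> ij; have : (i.+1 * k <= j * k)%N by rewrite leq_mul2r [(_ < _)%N]ij orbT.
  by rewrite mulSn; lia.
pose V (i : 'I_r) : {set 'I_n} := [set nth v sq (off i + l) | l : 'I_(len i)].
have bound (i : 'I_r) (l : 'I_(len i)) : (off i + l < size sq)%N.
  by rewrite ssq (leq_trans _ (off_n i)) // ltn_add2l.
have cV i : #|V i| = len i.
  rewrite card_imset ?card_ord // => l l' /eqP.
  by rewrite nth_uniq // eqn_add2l => /eqP/val_inj.
exists V; split.
- move=> i j _ /imsetP[l _ ->] /imsetP[l' _] /eqP; rewrite nth_uniq // => /eqP eqo.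
  apply: val_inj; case: (ltngtP i j) => // /off_mono h; exfalso.
    by move: (ltn_ord l); lia.
  by move: (ltn_ord l'); lia.
- apply/setP => u; rewrite inE; apply/imsetP/eqP => [[[[|l] hl] _ ->]//|->].
  by exists (Ordinal (ltnSn 0)).
- move=> i; rewrite inE => i3; split; last first.
    by rewrite cV; move: i3; case: (nat_of_ord i) => [|[|[|j]]].
  apply/subsetP => _ /imsetP[l _ ->].
  have : (0 < off i + l <= s * 2)%N.
    by case: l => l /=; move: i3; case: (nat_of_ord i) => [|[|[|j]]] //= _; lia.
  case: (off i + l)%N => [|l'] //= l's; rewrite nth_cat -cardE cA l's.
  by rewrite -mem_enum mem_nth // -cardE cA.
move=> i; rewrite inE => i3; rewrite cV.
by move: i3; case: (nat_of_ord i) => [|[|[|j]]].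
Qed.

Definition bad_pair v A E : bool :=
  [forall a in A, [set v; a] \in E] &&
  [forall a in A, forall b in A, (a != b) ==> ~~ clique_through r E v a b].

Lemma prod_blocks (V : 'I_r -> {set 'I_n}) (I : {set 'I_r}) : ord0 \in I ->
  (forall i, i \in hubs t -> #|V i| = s) -> (forall i, i \in far t -> #|V i| = k) ->
  (\prod_(i in ~: I) #|V i| = s ^ (2 - #|I :&: hubs t|) * k ^ (t - #|I :&: far t|))%N.
Proof.
move=> I0 Vhub Vfar; rewrite (bigID (mem (hubs t))) /=; congr (_ * _)%N.
  rewrite (eq_big (mem (hubs t :\: I)) (fun=> s)).
  - by rewrite prod_nat_const cardsD card_hubs setIC.
  - by move=> i; rewrite !inE.
  - by move=> i /andP[_ /Vhub].
have far_hub i : i \notin I -> (i \in far t) = (i \notin hubs t).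
  move=> iI; have : i != ord0 by apply: contraNneq iI => ->.
  by rewrite -val_eqE !inE /=; case: (nat_of_ord i) => [|[|[|j]]].
rewrite (eq_big (mem (far t :\: I)) (fun=> k)).
- by rewrite prod_nat_const cardsD card_far setIC.
- by move=> i; rewrite !inE; case: (boolP (i \in I)) => //= /far_hub; rewrite !inE => ->.
- by move=> i /andP[]; rewrite in_setC => /far_hub <- /Vfar.
Qed.

Variables (R : realFieldType) (p : R).
Hypotheses (p0 : 0 <= p) (p1 : p <= 1).
Hypothesis sparse_overlaps : forall a j : nat, (a <= 2)%N -> (j <= t)%N ->
  (a, j) != (2, t)%N -> (0 < shared a j)%N ->
  s%:R ^+ (2 - a) * k%:R ^+ (t - j) * p ^+ (shared 2 t - shared a j) <=
  (2 ^+ t.+4)^-1.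

Lemma Pr_bad_pair v A : #|A| = (s * 2)%N ->
  Pr (all_edges 'I_n) p (bad_pair v A) <=
  (1 - p ^+ shared 2 t / 2) ^+ (s ^ 2 * k ^ t).
Proof.
(* If v lies in A, the event requires the loop {v} as an edge and has probability 0. *)
move=> cA; have [vA|vA] := boolP (v \in A).
  rewrite (eq_Pr _ (B := pred0)); last first.
    move=> E EO; apply/negP => /andP[/forall_inP/(_ v vA) vE _].
    by have := subsetP EO _ vE; rewrite inE cards2 eqxx.
  rewrite /Pr big_pred0; last by move=> E; rewrite andbF.
  rewrite exprn_ge0 // subr_ge0 ler_pdivrMr // mul1r.
  by apply: (@le_trans _ _ 1); rewrite ?exprn_ile1 // ler1n.
have [V [disjV V0 Vhub Vfar]] := exists_blocks vA cA.
have inj_x x : x \in partite V -> injective x.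
  by move=> /partiteP xV i j eqx; apply: (disjV _ _ (x i)) => //; rewrite eqx.
have x0 x : x \in partite V -> x ord0 = v.
  by move=> /partiteP/(_ ord0); rewrite V0 inE => /eqP.
have -> : (s ^ 2 * k ^ t = \prod_i #|V i|)%N.
  rewrite (bigD1 ord0) //= V0 cards1 mul1n.
  rewrite (eq_bigl (fun i => i \in ~: [set ord0])); last by move=> i; rewrite !inE.
  have cap0 (B : {set 'I_r}) : ord0 \notin B -> #|[set ord0] :&: B| = 0%N.
    by move=> B0; apply/eqP; rewrite cards_eq0 setI_eq0 disjoints1.
  rewrite prod_blocks ?set11 ?cap0 ?subn0 ?inE //; by move=> i /Vhub[].
rewrite -card_pattern.
(* On the bad event all edges from v to A are present, so a partite copy of the pattern would
   complete to a K_r through v and two vertices of A. *)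
apply: (@le_trans _ _ (Pr (all_edges 'I_n) p
   (fun E => [forall x in partite V, ~~ (copy (pattern t) x \subset E)]))).
  apply: le_Pr => // E EO /andP[/forall_inP vE /forall_inP bad].
  apply/forall_inP => x xV; apply/negP => /subsetP cx.
  pose h1 := @Ordinal r 1 isT; pose h2 := @Ordinal r 2 isT.
  have xA h : h \in hubs t -> x h \in A.
    by case/Vhub => /subsetP + _; apply; exact/partiteP.
  have h1A : x h1 \in A by apply: xA; rewrite inE.
  have h2A : x h2 \in A by apply: xA; rewrite inE.
  have /forall_inP/(_ _ h2A) := bad _ h1A.
  rewrite (inj_eq (inj_x x xV)) /= => /negP; apply; apply/existsP.
  exists (x @: setT); rewrite card_imset ?cardsT ?card_ord ?eqxx /=; last exact: inj_x.
  rewrite -(x0 x) // !imset_f ?inE // !andbT.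
  apply/forall_inP => _ /imsetP[i _ ->]; apply/forall_inP => _ /imsetP[j _ ->].
  rewrite (inj_eq (inj_x x xV)); apply/implyP => ij.
  have [/imsetP[h hh eqh]|nh] := boolP ([set i; j] \in [set [set ord0; u] | u in hubs t]).
    have -> : [set x i; x j] = [set v; x h].
      by rewrite -!imset_set1 -!imsetU eqh imsetU !imset_set1 x0.
    by apply: vE; exact: xA.
  apply: cx; apply/imsetP; exists [set i; j]; last by rewrite imsetU !imset_set1.
  by rewrite inE nh inE cards2 ij.
apply: Pr_no_partite_copy => //.
  move=> x xV; apply/subsetP => _ /imsetP[q + ->]; rewrite !inE => /andP[_ /eqP q2].
  by rewrite card_imset ?q2 //; exact: inj_x.
(* The part of index 0 is a singleton, so I contains the root and its pattern edges are counted by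
   [shared]. *)
move=> I IT [q qQ qI] V1; have I0 : ord0 \in I by apply: V1; rewrite V0 cards1.
rewrite card_ord card_patternD //.
set a := #|I :&: hubs t|; set j := #|I :&: far t|.
have a2 : (a <= 2)%N by rewrite -(card_hubs t) subset_leq_card // subsetIr.
have jt : (j <= t)%N by rewrite -[X in (_ <= X)%N](card_far t) subset_leq_card // subsetIr.
have prodE : (\prod_(i in ~: I) #|V i| = s ^ (2 - a) * k ^ (t - j))%N.
  by rewrite prod_blocks // => i /Vhub[].
rewrite prodE natrM !natrX; apply: sparse_overlaps => //.
  apply: contra IT => /eqP[a2' jt']; rewrite eqEcard subsetT cardsT card_ord.
  by rewrite (card_rooted I0) -/a -/j a2' jt' add2n leqnn.
rewrite -card_pattern_powerset //; apply/card_gt0P; exists q.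
by rewrite inE qQ powersetE.
Qed.

Definition rich E : bool :=
  [forall v, forall A : {set 'I_n}, (#|A| == (s * 2)%N) ==> ~~ bad_pair v A E].

(** Union bound: one factor n + 1 covers the choice of v, and (n + 1)^(2s) that of A. *)
Lemma Pr_not_rich :
  Pr (all_edges 'I_n) p (predC rich) <=
  n.+1%:R ^+ (s * 2).+1 * (1 - p ^+ shared 2 t / 2) ^+ (s ^ 2 * k ^ t).
Proof.
pose B : {set {set 'I_n}} := [set A : {set 'I_n} | #|A| == (s * 2)%N].
apply: (@le_trans _ _ (\sum_(v : 'I_n) \sum_(A in B) Pr (all_edges 'I_n) p (bad_pair v A))).
  rewrite pair_big_dep /=; apply: Pr_union => // E _.
  rewrite /= negb_forall => /existsP[v]; rewrite negb_forall => /existsP[A].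
  rewrite negb_imply negbK => /andP[cA bad]; apply/hasP; exists (v, A).
    by rewrite mem_index_enum.
  by rewrite /= inE cA.
set P := leRHS.
apply: (@le_trans _ _ (\sum_(v : 'I_n) \sum_(A in B) (1 - p ^+ shared 2 t / 2) ^+ (s ^ 2 * k ^ t))).
  by apply: ler_sum => v _; apply: ler_sum => A; rewrite inE => /eqP; exact: Pr_bad_pair.
have e0 : 0 <= (1 - p ^+ shared 2 t / 2) ^+ (s ^ 2 * k ^ t).
  rewrite exprn_ge0 // subr_ge0 ler_pdivrMr // mul1r.
  by apply: (@le_trans _ _ 1); rewrite ?exprn_ile1 // ler1n.
rewrite !sumr_const card_ord -mulrnA -[leLHS]mulr_natl /P ler_wpM2r // -natrX ler_nat.
rewrite expnS mulnC leq_mul //.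
apply: leq_trans (_ : #|[set A : {set 'I_n} | (#|A| <= s * 2)%N]| <= _)%N.
  by apply: subset_leq_card; apply/subsetP => A; rewrite !inE => /eqP ->.
by have := card_small_sets 'I_n (s * 2); rewrite card_ord.
Qed.

Lemma num_orientations_rich E : rich E ->
  (num_orientations r E <= (n.+1 ^ (s * 2)) ^ n)%N.
Proof.
move=> /forallP richE; apply: num_orientations_le_exp => v A cA vA.
have /forallP/(_ A) := richE v; rewrite cA eqxx implyTb negb_and.
have -> : [forall a in A, [set v; a] \in E] by apply/forall_inP.
move=> /forall_inPn[a aA] /forall_inPn[b bA]; rewrite negb_imply negbK => /andP[ab cl].
by exists a, b.
Qed.

End RichNeighbourhoods.

(** * Numerical estimates *)

Section Overlaps.

Lemma bin2_double (n : nat) : ('C(n.+1, 2) * 2 = n.+1 * n)%N.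
Proof. by rewrite mulnC -mul_bin_diag bin1. Qed.

Lemma shared0_double (j : nat) : (shared 0 j * 2 = j * j.+1)%N.
Proof. by rewrite /shared subn0 bin2_double mulnC. Qed.

Lemma shared1_double (j : nat) : (shared 1 j * 2 = j * (j + 3))%N.
Proof. by rewrite /shared mulnBl bin2_double; lia. Qed.

Lemma shared2_double (j : nat) : (shared 2 j * 2 = j * (j + 5) + 2)%N.
Proof. by rewrite /shared mulnBl bin2_double; lia. Qed.

Lemma leq_shared (a j t : nat) : (a <= 2)%N -> (j <= t)%N ->
  (shared a j <= shared 2 t)%N.
Proof.
move=> a2 jt; rewrite -(leq_pmul2r (isT : 0 < 2)%N) shared2_double.
have jtj : (j * j <= t * t)%N by rewrite leq_mul.
case: a a2 => [|[|[|//]]] _.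
- by rewrite shared0_double; lia.
- by rewrite shared1_double; lia.
- by rewrite shared2_double; lia.
Qed.

Variables (R : realFieldType) (t : nat) (c k s y : R).
Hypotheses (y0 : 0 < y) (y1 : y <= 1) (k0 : 0 < k) (s0 : 0 <= s) (c1 : 1 <= c).
Hypothesis many_copies : 1 <= k * y ^+ (t + 3).
Hypothesis few_pairs : c * (k * y ^+ (t + 5)) <= 1.
Hypothesis few_single : c * (s * k ^+ t * (y ^+ 2) ^+ shared 2 t) <= k * y ^+ (t + 3).
Hypothesis few_disjoint : c * (s ^+ 2 * k ^+ t * (y ^+ 2) ^+ shared 2 t) <= k * y ^+ 2.

Lemma ler_kyX (i j : nat) : (i <= j)%N -> k * y ^+ j <= k * y ^+ i.
Proof. by move=> ij; rewrite ler_pM2l // ler_wiXn2l // ltW. Qed.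

(** Here y^2 plays the role of p. For a <= 1, multiplying by k^j p^(shared a j) reduces the claim,
    via [main], to a lower bound for that product. *)
Lemma overlap_bound (a j : nat) : (a <= 2)%N -> (j <= t)%N ->
  (a, j) != (2, t)%N -> (0 < shared a j)%N ->
  s ^+ (2 - a) * k ^+ (t - j) * (y ^+ 2) ^+ (shared 2 t - shared a j) <= c^-1.
Proof.
move=> a2 jt ajn sh; have c0 : 0 < c by apply: lt_le_trans c1.
have kj0 : 0 < k ^+ j * (y ^+ 2) ^+ shared a j by rewrite mulr_gt0 // ?exprn_gt0.
rewrite -div1r ler_pdivlMr // mulrC.
have main : c * (s ^+ (2 - a) * k ^+ t * (y ^+ 2) ^+ shared 2 t) <= k ^+ j * (y ^+ 2) ^+ shared a j ->
    c * (s ^+ (2 - a) * k ^+ (t - j) * (y ^+ 2) ^+ (shared 2 t - shared a j)) <= 1.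
  move=> h; rewrite -(ler_pM2r kj0) mul1r; apply: le_trans h.
  have -> : k ^+ t = k ^+ (t - j) * k ^+ j by rewrite -exprD subnK.
  have -> : (y ^+ 2) ^+ shared 2 t =
      (y ^+ 2) ^+ (shared 2 t - shared a j) * (y ^+ 2) ^+ shared a j.
    by rewrite -exprD subnK // leq_shared.
  by rewrite le_eqVlt; apply/orP; left; apply/eqP; ring.
case: a a2 ajn sh kj0 main => [|[|[|//]]] _ ajn sh kj0 main.
(* Case a = 0. With j + 1 far indices the right side is k y^2 (k y^(j+3))^j, whose last factor is at
   least 1 by [many_copies]. *)
- apply: main; rewrite subn0; apply: le_trans few_disjoint _.
  case: j jt sh ajn kj0 => [|j] jt sh _ _; first by rewrite /shared in sh.
  have -> : k ^+ j.+1 * (y ^+ 2) ^+ shared 0 j.+1 = k * y ^+ 2 * (k * y ^+ (j + 3)) ^+ j.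
    rewrite -exprM (_ : (2 * shared 0 j.+1 = 2 + (j + 3) * j)%N); last first.
      by rewrite mulnC shared0_double; lia.
    by rewrite exprS exprD exprMn -exprM; ring.
  rewrite ler_pMr ?mulr_gt0 ?exprn_gt0 // exprn_ege1 //.
  by apply: le_trans many_copies _; apply: ler_kyX; lia.
(* Case a = 1. The right side is (k y^(j+4))^(j+1) with j + 4 <= t + 3, hence at least k y^(t+3). *)
- apply: main; rewrite subn1 expr1; apply: le_trans few_single _.
  case: j jt sh ajn kj0 => [|j] jt sh _ _; first by rewrite /shared in sh.
  have -> : k ^+ j.+1 * (y ^+ 2) ^+ shared 1 j.+1 = (k * y ^+ (j + 4)) ^+ j.+1.
    rewrite -exprM (_ : (2 * shared 1 j.+1 = (j + 4) * j.+1)%N); last first.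
      by rewrite mulnC shared1_double; lia.
    by rewrite exprMn -exprM.
  have le1 : k * y ^+ (t + 3) <= k * y ^+ (j + 4) by apply: ler_kyX; lia.
  apply: le_trans le1 _; rewrite exprS ler_pMr ?mulr_gt0 ?exprn_gt0 // exprn_ege1 //.
  by apply: le_trans many_copies _; apply: ler_kyX; lia.
(* Case a = 2. The left side is c (k y^(t+5+j))^(t-j); the base is at most k y^(t+5) <= 1 and, as j
   < t, one factor is available to absorb c. *)
have jt' : (j < t)%N.
  by rewrite ltn_neqAle jt andbT; apply: contraNneq ajn => ->.
rewrite subnn expr0 mul1r; apply: le_trans few_pairs; rewrite ler_pM2l //.
have -> : k ^+ (t - j) * (y ^+ 2) ^+ (shared 2 t - shared 2 j) = (k * y ^+ (t + 5 + j)) ^+ (t - j).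
  rewrite -exprM (_ : (2 * (shared 2 t - shared 2 j) = (t + 5 + j) * (t - j))%N).
    by rewrite exprMn -exprM.
  rewrite mulnC mulnBl !shared2_double; clear -jt'.
  by have [d ->] : exists d, t = (j + d)%N; [exists (t - j)%N; lia|nia].
have ky1 : k * y ^+ (t + 5) <= 1.
  by apply: le_trans few_pairs; rewrite ler_peMl // mulr_ge0 ?exprn_ge0 // ltW.
have le1 : k * y ^+ (t + 5 + j) <= k * y ^+ (t + 5) by exact: ler_kyX (leq_addr _ _).
have ge0 : 0 <= k * y ^+ (t + 5 + j) by rewrite mulr_ge0 ?exprn_ge0 // ltW.
rewrite -(subnSK jt') exprS; apply: (le_trans _ le1).
by rewrite ler_piMr // exprn_ile1 // (le_trans le1).
Qed.

End Overlaps.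

(** * The sparse and dense ranges of p *)

Section Regimes.
Variables (R : realType) (t : nat).
Notation r := t.+3.

(* There are about n / D candidates for each of the r - 3 free vertices of a K_r,
   and a, b are sought in sets of size about K L / q. *)
Variables D K C : R.
Hypotheses (DE : D = 2 ^+ t.+4) (KE : K = 16 * (2 * D) ^+ t)
  (CE : C = 8 * K ^+ 2 * D ^+ 2).

Let D_ge16 : 16 <= D.
Proof.
by rewrite DE -natrX (ler_nat R 16) (leq_pexp2l (m := 2) (n1 := 4)).
Qed.

Let K_ge16 : 16 <= K.
Proof.
rewrite KE ler_pMr //; apply: exprn_ege1; have := D_ge16; lra.
Qed.

Let C_ge8K : 8 * K <= C.
Proof.
rewrite CE; have d1 : 1 <= D ^+ 2 by apply: exprn_ege1; have := D_ge16; lra.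
by have := K_ge16; move: (D ^+ 2) d1 => e e1; nra.
Qed.

Variables (n : nat) (p : R).
Notation N := (n%:R : R).
Notation L := (ln N).
Notation q := (N ^+ t * p ^+ shared 2 t).
Hypotheses (p_gt0 : 0 < p) (L_ge1 : 1 <= L).
Hypothesis p_small : N ^+ 2 * p ^+ (t + 5) <= 1.

(** The square root avoids half-integral exponents: [p_small] becomes N y^(t+5) <= 1, and q = (N
    y^(t+5))^t p. *)
Let y := Num.sqrt p.
Let yE : y ^+ 2 = p. Proof. by rewrite sqr_sqrtr // ltW. Qed.
Let y_gt0 : 0 < y. Proof. by rewrite sqrtr_gt0. Qed.

Lemma vertices_gt1 : 1 < N.
Proof.
have : 0 < L by apply: lt_le_trans L_ge1.
rewrite ltNge => L0; rewrite ltNge; apply: contra L0; exact: ln_le0.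
Qed.
Let N_gt0 : 0 < N. Proof. exact: lt_trans vertices_gt1. Qed.
Let N_ge1 : 1 <= N. Proof. exact: ltW vertices_gt1. Qed.

Lemma expR_L : expR L = N.
Proof. by rewrite lnK // posrE. Qed.

Let Ny_le1 : N * y ^+ (t + 5) <= 1.
Proof.
rewrite leNgt; apply/negP => h.
have : 1 < (N * y ^+ (t + 5)) ^+ 2 by rewrite exprn_egt1.
by rewrite exprMn exprAC yE ltNge p_small.
Qed.

Lemma p_le1 : p <= 1.
Proof.
rewrite leNgt; apply/negP => h; move: p_small; apply/negP; rewrite -ltNge.
rewrite -[ltLHS]mulr1 ltr_pM // ?exprn_egt1 ?vertices_gt1 //.
by rewrite addnC.
Qed.

Let qE : q = (N * y ^+ (t + 5)) ^+ t * p.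
Proof.
rewrite exprMn -exprM -mulrA; congr (_ * _).
rewrite -yE -!exprM -exprD; congr (_ ^+ _).
by rewrite mulnC shared2_double; lia.
Qed.

Lemma q_gt0 : 0 < q.
Proof. by rewrite mulr_gt0 ?exprn_gt0. Qed.

Lemma q_le1 : q <= 1.
Proof.
rewrite qE mulr_ile1 // ?p_le1 //; last 2 first.
- exact: ltW.
- by rewrite exprn_ile1 // mulr_ge0 // ?exprn_ge0 // ltW.
by rewrite exprn_ge0 // mulr_ge0 // ?exprn_ge0 // ltW.
Qed.

Let prob := Pr (all_edges 'I_n) p
  (fun E => (num_orientations r E)%:R <= expR (C * (N * L ^+ 2 / q))).

Let p01 : 0 <= p. Proof. exact: ltW. Qed.

(** Markov's inequality, with the count bounded by 2^|E|, whose expectation (1 + p)^C(n,2) is at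
    most exp(p n^2 / 2). The exponent M satisfies M >= n^2 p by sparseness and M >= 2L, so M - L >=
    p n^2 / 2. *)
Lemma sparse_regime : N * p * q <= C * L ^+ 2 -> 1 - N^-1 <= prob.
Proof.
move=> sparse; rewrite /prob Pr_predC lerD2l lerN2.
set M := C * (N * L ^+ 2 / q).
have Mpos : 0 < expR M by exact: expR_gt0.
have M_ge : N ^+ 2 * p <= M.
  rewrite /M mulrA ler_pdivlMr ?q_gt0 //.
  have -> : N ^+ 2 * p * q = N * (N * p * q) by ring.
  have -> : C * (N * L ^+ 2) = N * (C * L ^+ 2) by ring.
  by rewrite ler_pM2l.
have M_L : 2 * L <= M.
  have : L ^+ 2 <= N * L ^+ 2 / q.
    rewrite ler_pdivlMr ?q_gt0 // mulrC ler_wpM2r ?sqr_ge0 //.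
    exact: le_trans q_le1 N_ge1.
  have : 2 <= C by apply: le_trans C_ge8K; have := K_ge16; lra.
  rewrite /M; move: (N * L ^+ 2 / q) => z C2 zL; apply: (@le_trans _ _ (2 * z)).
    by rewrite ler_pM2l // (le_trans _ zL) // expr2 ler_peMr // (le_trans _ L_ge1).
  by rewrite ler_wpM2r // (le_trans _ zL) // sqr_ge0.
apply: (@le_trans _ _ (Pr (all_edges 'I_n) p (fun E => expR M < (num_orientations r E)%:R))).
  by apply: le_Pr => //; [exact: p_le1|move=> E _ /=; rewrite -ltNge].
apply: le_trans (Pr_markov _ p01 p_le1 Mpos _) _ => //.
rewrite ler_pdivrMr // -expR_L -expRN -expRD.
apply: (@le_trans _ _ (\sum_(E in powerset (all_edges 'I_n))
    (2 * p) ^+ #|E| * (1 - p) ^+ #|(all_edges 'I_n :\: E)%SET|)).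
  apply: ler_sum => E _; rewrite /subset_weight exprMn mulrAC ler_wpM2r ?exprn_ge0 ?subr_ge0 ?p_le1 //.
  rewrite [leRHS]mulrC ler_wpM2l ?exprn_ge0 // -natrX ler_nat.
  exact: num_orientations_le_edges.
rewrite sum_powerset_exp (_ : 2 * p + (1 - p) = 1 + p); last by ring.
apply: (@le_trans _ _ (expR (p * #|all_edges 'I_n|%:R))).
  by rewrite expRM_natr; apply: lerXn2r; rewrite ?nnegrE ?expR_ge0 ?addr_ge0 ?expR_ge1Dx.
rewrite ler_expR.
have -> : #|all_edges 'I_n| = 'C(n, 2) by rewrite card_draws card_ord.
have : p * 'C(n, 2)%:R * 2 <= N ^+ 2 * p.
  rewrite -mulrA mulrC ler_pM2r // -natrM -natrX ler_nat.
  by case: (n) => // m; rewrite bin2_double expnS expn1 leq_mul.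
move: M_ge M_L; set x := p * _; set z := N ^+ 2 * p; lra.
Qed.

Hypothesis N_big : (4 * D ^+ 2 * K * L) ^+ (t + 4) <= N.

(** This is the lower bound on N y^(t+3) that the overlap estimates require; the power t + 4 in
    [N_big] serves [X_le_Ny]. *)
Let X := 4 * D ^+ 2 * K * L.

Let D_ge0 : 0 <= D. Proof. by have := D_ge16; lra. Qed.
Let K_ge0 : 0 <= K. Proof. by have := K_ge16; lra. Qed.

Let X_ge : 4 * D ^+ 2 * K <= X.
Proof.
by rewrite /X ler_peMr // !mulr_ge0.
Qed.

Let X_ge16D : 16 * D <= X.
Proof.
apply: le_trans X_ge; have := K_ge16; have := D_ge16.
by rewrite expr2; nra.
Qed.

Let X_le_N : X <= N.
Proof.
have X1 : 1 <= X by apply: le_trans X_ge16D; have := D_ge16; lra.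
apply: le_trans N_big; rewrite addn4 exprS ler_peMr ?exprn_ege1 //.
exact: le_trans X1.
Qed.

Let k := (n %/ 2 ^ t.+4)%N.
(** The successor rounds K L / q up; as K L / q >= 1, at most a factor 2 is lost. *)
Let s := (Num.truncn (K * L / q)).+1.

Let block_le : D * k%:R <= N.
Proof. by rewrite DE -natrX -natrM ler_nat mulnC leq_trunc_div. Qed.

Let k_gt0 : (0 < k)%N.
Proof.
rewrite divn_gt0 ?expn_gt0 // -(ler_nat R) natrX -DE.
by apply: le_trans X_le_N; apply: le_trans X_ge16D; have := D_ge16; lra.
Qed.

Let block_ge : N <= 2 * D * k%:R.
Proof.
rewrite DE -natrX -!natrM ler_nat; move: k_gt0; rewrite /k.
have : (0 < 2 ^ t.+4)%N by rewrite expn_gt0.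
move: (2 ^ t.+4)%N => d d0; have := ltn_ceil n d0.
by move: (n %/ d)%N => m; clear; nia.
Qed.

Let sel_ge : K * L / q <= s%:R.
Proof. exact/ltW/truncnS_gt. Qed.

Let KLq_ge1 : 1 <= K * L / q.
Proof.
rewrite ler_pdivlMr ?q_gt0 // mul1r (le_trans q_le1) //.
by have := K_ge16; have := L_ge1; nra.
Qed.

Let sel_le : s%:R <= 2 * (K * L / q).
Proof.
have h : (Num.truncn (K * L / q))%:R <= K * L / q.
  by rewrite truncn_le // (le_trans _ KLq_ge1).
by rewrite /s -addn1 natrD; have := KLq_ge1; lra.
Qed.

Let s_ge1 : 1 <= s%:R :> R. Proof. by rewrite ler1n. Qed.

Section Dense.
Hypothesis dense : C * L ^+ 2 < N * p * q.

Let L2q : 8 * K ^+ 2 * D ^+ 2 * (L ^+ 2 / q) < N * p.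
Proof. by rewrite mulrA ltr_pdivrMr ?q_gt0 // -CE. Qed.

(** The power (N y^(t+4))^(t+1) equals N p q, which exceeds C L^2 >= 1. *)
Let dense_y : 1 <= N * y ^+ (t + 4).
Proof.
rewrite leNgt; apply/negP => h.
have : (N * y ^+ (t + 4)) ^+ t.+1 <= 1.
  by rewrite exprn_ile1 ?ltW // mulr_gt0 // exprn_gt0.
have -> : (N * y ^+ (t + 4)) ^+ t.+1 = N * p * q.
  have -> : p ^+ shared 2 t = y ^+ (t * (t + 5) + 2).
    by rewrite -shared2_double mulnC exprM yE.
  rewrite exprMn -exprM -[in RHS]yE.
  have -> : ((t + 4) * t.+1 = t * (t + 5) + 2 + 2)%N by clear; lia.
  by rewrite exprS exprD; ring.
apply/negP; rewrite -ltNge; apply: le_lt_trans dense.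
have : 1 <= C by apply: le_trans C_ge8K; have := K_ge16; lra.
have : 1 <= L ^+ 2 by exact: exprn_ege1.
by move: (L ^+ 2) C => l c; nra.
Qed.

(** The power (N y^(t+3))^(t+4) equals N (N y^(t+4))^(t+3), which is at least N >= X^(t+4). *)
Let X_le_Ny : X <= N * y ^+ (t + 3).
Proof.
rewrite leNgt; apply/negP => h.
have X0 : 0 <= X by apply: le_trans X_ge16D; have := D_ge16; lra.
have : (N * y ^+ (t + 3)) ^+ (t + 4) < N.
  apply: lt_le_trans N_big; rewrite ltr_pXn2r ?nnegrE ?addn4 //.
  by rewrite mulr_ge0 ?exprn_ge0 // ltW.
apply/negP; rewrite -leNgt.
have -> : (N * y ^+ (t + 3)) ^+ (t + 4) = N * (N * y ^+ (t + 4)) ^+ (t + 3).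
  rewrite !exprMn -!exprM [((t + 3) * _)%N]mulnC mulrA -exprS.
  by congr (_ ^+ _ * _); clear; lia.
by rewrite ler_peMr // ?exprn_ege1 // ltW.
Qed.

Let block_copies : X <= 2 * D * (k%:R * y ^+ (t + 3)).
Proof.
by apply: le_trans X_le_Ny _; rewrite mulrA ler_wpM2r // exprn_ge0 // ltW.
Qed.

Let beta_le : s%:R * k%:R ^+ t * p ^+ shared 2 t <= 2 * (K * L).
Proof.
apply: (@le_trans _ _ (s%:R * q)).
  rewrite -mulrA ler_wpM2l // ler_wpM2r ?exprn_ge0 //.
  apply: lerXn2r; rewrite ?nnegrE //; apply: le_trans block_le.
  by rewrite ler_peMl //; have := D_ge16; lra.
apply: le_trans (ler_wpM2r (ltW q_gt0) sel_le) _.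
by rewrite -!mulrA mulVf ?mulr1 // gt_eqF // q_gt0.
Qed.

(** This is [overlap_bound] with c = D; the coefficients in X and C are chosen for its last two
    hypotheses. *)
Let overlaps (a j : nat) : (a <= 2)%N -> (j <= t)%N ->
  (a, j) != (2, t)%N -> (0 < shared a j)%N ->
  s%:R ^+ (2 - a) * k%:R ^+ (t - j) * p ^+ (shared 2 t - shared a j) <= (2 ^+ t.+4)^-1.
Proof.
move=> a2 jt ajn sh; rewrite -yE; apply: overlap_bound => //.
- by rewrite -(@expr_le1 _ 2) ?yE ?p_le1 // ltW.
- by rewrite ltr0n.
- by rewrite exprn_ege1 // ler1n.
- have := block_copies; have := X_ge16D; have := D_ge16.
  by move=> d16 h1 h2; rewrite leNgt; apply/negP => z1; nra.
- apply: le_trans Ny_le1; rewrite mulrA -DE ler_wpM2r ?exprn_ge0 //.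
  exact: ltW.
(* [few_single]: multiplied by 2D, the bound 2 D K L becomes exactly X. *)
- rewrite yE -DE.
  apply: (@le_trans _ _ (D * (2 * (K * L)))).
    by rewrite ler_wpM2l // exprn_ge0.
  have D0 : 0 < 2 * D by have := D_ge16; lra.
  rewrite -(ler_pM2l D0); apply: le_trans block_copies.
  by rewrite le_eqVlt; apply/orP; left; apply/eqP; rewrite /X; ring.
(* [few_disjoint]: multiplied by 2D, with s <= 2 K L / q, the left side is at most 8 K^2 D^2 L^2 / q
   < N p. *)
rewrite yE -DE.
have D0 : 0 < 2 * D by have := D_ge16; lra.
rewrite -(ler_pM2l D0) [leRHS]mulrA; apply: (@le_trans _ _ (N * p)); last first.
  by rewrite ler_wpM2r.
apply: le_trans (ltW L2q).
have -> : 2 * D * (D * (s%:R ^+ 2 * k%:R ^+ t * p ^+ shared 2 t)) =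
    2 * D ^+ 2 * (s%:R * (s%:R * k%:R ^+ t * p ^+ shared 2 t)) by ring.
have -> : 8 * K ^+ 2 * D ^+ 2 * (L ^+ 2 / q) =
    2 * D ^+ 2 * (2 * (K * L / q) * (2 * (K * L))) by ring.
rewrite ler_wpM2l ?mulr_ge0 ?sqr_ge0 // ler_pM // !mulr_ge0 ?exprn_ge0 //.
Qed.

(** Each of 1, s and t k is at most n / 16; for t k this uses D = 16 2^t, for s the density
    assumption. *)
Let room : (1 + s * 2 + t * k <= n)%N.
Proof.
rewrite -(ler_nat R) !natrD !natrM.
have tk : 16 * (t%:R * k%:R) <= N.
  apply: le_trans block_le; rewrite mulrA ler_wpM2r //.
  have -> : D = 16 * 2 ^+ t by rewrite DE !exprS; ring.
  by rewrite ler_pM2l // -natrX ler_nat ltnW // ltn_expl.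
have N16 : 16 <= N.
  by apply: le_trans X_le_N; apply: le_trans X_ge16D; have := D_ge16; lra.
have s16 : 16 * s%:R <= N.
  apply: (@le_trans _ _ (16 * (2 * (K * L / q)))); first by rewrite ler_wpM2l.
  apply: (@le_trans _ _ (N * p)); last by rewrite ler_piMr ?p_le1 // ltW.
  apply: le_trans (ltW L2q).
  have Lq : K * L / q <= K * (L ^+ 2 / q).
    rewrite -mulrA ler_wpM2l //.
    by rewrite ler_wpM2r ?invr_ge0 ?(ltW q_gt0) // expr2 ler_peMr // (le_trans _ L_ge1).
  have Lq0 : 0 <= K * (L ^+ 2 / q) by apply: le_trans Lq; apply: le_trans KLq_ge1.
  apply: (@le_trans _ _ (32 * (K * (L ^+ 2 / q)))); first by lra.
  have -> : 8 * K ^+ 2 * D ^+ 2 * (L ^+ 2 / q) = (8 * K * D ^+ 2) * (K * (L ^+ 2 / q)) by ring.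
  rewrite ler_wpM2r //; have := K_ge16; have := D_ge16.
  by rewrite expr2; nra.
by lra.
Qed.

Let succ_le : n.+1%:R <= expR (2 * L).
Proof.
have N16 : 16 <= N.
  by apply: le_trans X_le_N; apply: le_trans X_ge16D; have := D_ge16; lra.
rewrite expRM_natl expR_L -addn1 natrD expr2; nra.
Qed.

(** On rich graphs the count is at most (n + 1)^(2sn) <= exp(4 s n L) <= exp(8 K n L^2 / q). For the
    others, the union bound costs exp(2L(2s + 1)) against exp(-8sL), leaving at most exp(-L) =
    1/n. *)
Lemma dense_regime : 1 - N^-1 <= prob.
Proof.
rewrite /prob Pr_predC lerD2l lerN2.
apply: (@le_trans _ _ (Pr (all_edges 'I_n) p (predC (rich t s)))).
  apply: le_Pr => //; first exact: p_le1.
  move=> E _ /=; apply: contra => /num_orientations_rich h.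
  rewrite -(ler_nat R) in h; apply: le_trans h _.
  rewrite -expnM natrX; apply: (@le_trans _ _ (expR (2 * L) ^+ (s * 2 * n))).
    by apply: lerXn2r; rewrite ?nnegrE ?expR_ge0.
  rewrite -expRM_natr ler_expR !natrM.
  apply: (@le_trans _ _ (8 * K * (N * L ^+ 2 / q))); last first.
    rewrite ler_wpM2r ?C_ge8K // mulr_ge0 ?invr_ge0 ?(ltW q_gt0) //.
    by rewrite mulr_ge0 ?sqr_ge0 // ltW.
  have -> : 2 * L * (s%:R * 2 * N) = 4 * (L * N) * s%:R by ring.
  have -> : 8 * K * (N * L ^+ 2 / q) = 4 * (L * N) * (2 * (K * L / q)) by ring.
  by rewrite ler_wpM2l // !mulr_ge0 // (le_trans _ L_ge1).
apply: le_trans (Pr_not_rich room p01 p_le1 overlaps) _.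
rewrite -expR_L -expRN.
have pm : p ^+ shared 2 t / 2 <= 1.
  rewrite ler_pdivrMr // mul1r; apply: (@le_trans _ _ 1); last by rewrite ler1n.
  by rewrite exprn_ile1 // p_le1.
apply: (@le_trans _ _ (expR (2 * L) ^+ (s * 2).+1 *
    expR (- (p ^+ shared 2 t / 2)) ^+ (s ^ 2 * k ^ t))).
  rewrite ler_pM ?exprn_ge0 ?subr_ge0 //.
    by apply: lerXn2r; rewrite ?nnegrE ?expR_ge0.
  by apply: lerXn2r; rewrite ?nnegrE ?expR_ge0 ?subr_ge0 // expR_ge1Dx.
rewrite -!expRM_natr -expRD ler_expR (natrM _ (s ^ 2)) !natrX -[(s * 2).+1]addn1 natrD (natrM _ s).
(* The factor (2D)^t in K makes up for k being only at least N / (2D); the 16 remains. *)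
have copies : 16 * (s%:R * L) <= s%:R ^+ 2 * k%:R ^+ t * p ^+ shared 2 t.
  have D0 : 0 < (2 * D) ^+ t by rewrite exprn_gt0 //; have := D_ge16; lra.
  rewrite -(ler_pM2l D0).
  apply: (@le_trans _ _ (s%:R * (s%:R * q))).
    have -> : (2 * D) ^+ t * (16 * (s%:R * L)) = s%:R * (K * L) by rewrite KE; ring.
    by rewrite ler_wpM2l // -ler_pdivrMr // q_gt0.
  have -> : s%:R * (s%:R * q) = s%:R ^+ 2 * p ^+ shared 2 t * N ^+ t by ring.
  have -> : (2 * D) ^+ t * (s%:R ^+ 2 * k%:R ^+ t * p ^+ shared 2 t) =
      s%:R ^+ 2 * p ^+ shared 2 t * (2 * D * k%:R) ^+ t by rewrite [in RHS]exprMn; ring.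
  rewrite ler_wpM2l ?mulr_ge0 ?exprn_ge0 //.
  by apply: lerXn2r; rewrite ?nnegrE // (le_trans _ block_ge).
have sL : L <= s%:R * L by rewrite ler_peMl // (le_trans _ L_ge1).
have -> : - (p ^+ shared 2 t / 2) * (s%:R ^+ 2 * k%:R ^+ t) =
   - (s%:R ^+ 2 * k%:R ^+ t * p ^+ shared 2 t) / 2 by ring.
have -> : 2 * L * (s%:R * 2 + 1) = 4 * (s%:R * L) + 2 * L by ring.
by move: (s%:R * L) (_ * p ^+ _) L L_ge1 sL copies => x P l; lra.
Qed.

End Dense.

Lemma num_orientations_likely : 1 - N^-1 <= prob.
Proof.
by case: (leP (N * p * q) (C * L ^+ 2)); [exact: sparse_regime|exact: dense_regime].
Qed.

End Regimes.

(** * Letting n tend to infinity *)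

Lemma near_infty_lnX_le (R : realType) (c : R) (d : nat) : 0 <= c ->
  \forall n \near \oo%classic, 1 <= ln (n%:R : R) /\ (c * ln n%:R) ^+ d <= n%:R.
Proof.
(* Since e^l >= (l / (d+1))^(d+1), having l >= c^d (d+1)^(d+1) gives (c l)^d <= e^l; the extra 1
   ensures l >= 1. *)
move=> c0; pose b : R := c ^+ d * d.+1%:R ^+ d.+1 + 1.
near=> n.
have n_ge : expR b <= n%:R by near: n; exact: nbhs_infty_ger.
have n_gt0 : 0 < n%:R :> R by apply: lt_le_trans n_ge; exact: expR_gt0.
have L_ge : b <= ln n%:R by rewrite -[leLHS]expRK ler_ln // posrE expR_gt0.
have b_ge1 : 1 <= b by rewrite /b lerDr mulr_ge0 // exprn_ge0.
split; first exact: le_trans L_ge.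
rewrite -[leRHS]lnK ?posrE //; move: (ln _) L_ge => l bl.
have l0 : 0 <= l by apply: le_trans bl; apply: le_trans b_ge1.
have -> : expR l = expR (l / d.+1%:R) ^+ d.+1.
  by rewrite -expRM_natr divfK // pnatr_eq0.
apply: (@le_trans _ _ ((l / d.+1%:R) ^+ d.+1)); last first.
  apply: lerXn2r; rewrite ?nnegrE ?expR_ge0 ?divr_ge0 //.
  by apply: le_trans (expR_ge1Dx _); rewrite lerDr.
rewrite exprMn [leRHS]exprMn exprVn [X in _ <= X / _]exprSr ler_pdivlMr ?exprn_gt0 ?ltr0n //.
rewrite mulrAC mulrC ler_wpM2l ?exprn_ge0 //; apply: le_trans bl.
by rewrite /b lerDl.
Unshelve. all: by end_near. Qed.

Local Open Scope classical_set_scope.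
Local Open Scope ring_scope.

Theorem theorem4p2 (R : realType) (r : nat) (hr : (4 <= r)%N) :
  exists C : R, 0 < C /\
    forall p : nat -> R,
      (forall n : nat, (0 < n)%N ->
         0 <= p n /\ p n <= n%:R `^ (- (2 / (r%:R + 2)))) ->
      (fun n : nat =>
         gnp_prob (p n) (fun E : {set {set 'I_n}} =>
           (num_orientations r E)%:R <=
             expR (C * (n%:R `^ (4 - r%:R) * ln n%:R ^+ 2)
                   / p n ^+ ('C(r, 2) - 2))))
        @ \oo --> (1 : R).
Proof.
have [t tr] : exists t, r = t.+3 by exists (r - 3)%N; lia.
subst r; pose D : R := 2 ^+ t.+4; pose K : R := 16 * (2 * D) ^+ t.
have D_gt0 : 0 < D by rewrite exprn_gt0.
have K_gt0 : 0 < K by rewrite !mulr_gt0 // exprn_gt0 // mulr_gt0.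
exists (8 * K ^+ 2 * D ^+ 2); split.
  by rewrite mulr_gt0 ?exprn_gt0 // mulr_gt0 // exprn_gt0.
move=> p p_small.
have sub1V : (fun n : nat => 1 - n%:R^-1 : R) @ \oo --> (1 : R).
  rewrite -[X in _ --> X]subr0; apply: cvgB; first exact: cvg_cst.
  apply/gtr0_cvgV0; last exact: cvgr_idn.
  by near=> n; rewrite ltr0n; near: n; exact: nbhs_infty_gt.
apply: (squeeze_cvgr _ sub1V (cvg_cst (1 : R))); near=> n.
have [L_ge1 N_big] : 1 <= ln (n%:R : R) /\ (4 * D ^+ 2 * K * ln n%:R) ^+ (t + 4) <= n%:R.
  near: n; apply: near_infty_lnX_le; apply/ltW.
  by rewrite mulr_gt0 // mulr_gt0 // exprn_gt0.
have n_gt0 : (0 < n)%N by near: n; exact: nbhs_infty_gt.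
have N_gt0 : 0 < n%:R :> R by rewrite ltr0n.
have [p0 p_le] := p_small n n_gt0.
rewrite /gnp_prob -/(subset_weight _ _ _) -/(Pr _ _ _).
(* As r + 2 = t + 5, the power t + 5 of the bound on p is n^(-2). *)
have small : n%:R ^+ 2 * p n ^+ (t + 5) <= 1.
  rewrite mulrC -ler_pdivlMr ?exprn_gt0 // div1r.
  have -> : n%:R ^- 2 = (n%:R `^ (- (2 / (t.+3%:R + 2)))) ^+ (t + 5) :> R.
    rewrite -powR_mulrn ?powR_ge0 // -powRrM.
    have -> : - (2 / (t.+3%:R + 2)) * (t + 5)%:R = - 2%:R :> R.
      have -> : (t + 5)%:R = t.+3%:R + 2 :> R by rewrite -natrD; congr _%:R; lia.
      by rewrite mulNr divfK // -natrD pnatr_eq0 addn_eq0.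
    by rewrite powRN powR_mulrn // ltW.
  by apply: lerXn2r; rewrite ?nnegrE ?powR_ge0.
have p1 : p n <= 1.
  exact: p_le1 L_ge1 small.
rewrite Pr_le1 // andbT.
(* For p = 0, division by zero makes the exponent 0 and the bound 1. It still holds: all the mass is
   on the empty graph, which has at most one orientation. *)
have [pz|p_neq0] := eqVneq (p n) 0.
  apply: (@le_trans _ _ 1); first by rewrite lerBlDr lerDl invr_ge0.
  rewrite pz /Pr (bigD1 finset.set0) /=; last first.
    rewrite powersetE finset.sub0set expr0n (_ : _ == 0%N = false); last first.
      by rewrite -[X in X == _]/(shared 2 t) -(eqn_pmul2r (isT : 0 < 2)%N) shared2_double addn2.
    rewrite invr0 mulr0 expR0 lern1.
    by have := num_orientations_le_edges t.+3 (finset.set0 : {set {set 'I_n}}); rewrite cards0.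
  rewrite /subset_weight cards0 expr0 mul1r subr0 expr1n lerDl.
  by apply: sumr_ge0 => E _; rewrite mulr_ge0 ?exprn_ge0 ?subr0.
have p_gt0 : 0 < p n by rewrite lt_def p_neq0.
have := num_orientations_likely (erefl D) (erefl K) (erefl _) p_gt0 L_ge1 small N_big.
congr (_ <= Pr _ _ _); apply/funext => E; congr (_ <= expR _).
(* Since n^(4-r) = n / n^t, the exponent is the C n L^2 / q of the two regimes. *)
have -> : (4 - t.+3%:R = 1 - t%:R :> R) by rewrite -addn3 natrD; ring.
rewrite powRB; last by rewrite (gt_eqF N_gt0) implybT.
rewrite powRr1 ?ltW // powR_mulrn ?ltW //.
by rewrite -[('C(t.+3, 2) - 2)%N]/(shared 2 t) invfM; ring.
Unshelve. all: by end_near. Qed.
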